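(* Let $q$ be an odd prime power, $\alpha\in\mathrm{GF}(q^2)\setminus\{0\}$ and $\beta\in\mathrm{GF}(q^2)\setminus\mathrm{GF}(q)$ with $4\alpha^{q+1}+(\beta^q-\beta)^2\neq 0$, and let $\mathcal M_{\alpha,\beta}$ be the corresponding BM quasi-Hermitian variety of $\mathrm{PG}(3,q^2)$. Let $\ell_1,\ell_2$ be the two lines at infinity and $P_\infty=(0,0,0,1)$ (all as defined in the context). (1) If $q\equiv 1\pmod 4$, then through each affine point of $\mathcal M_{\alpha,\beta}$ there pass exactly two lines contained in $\mathcal M_{\alpha,\beta}$; through each point of $\ell_1\cup\ell_2$ there pass exactly $q+1$ lines contained in $\mathcal M_{\alpha,\beta}$, and these belong to a pencil (i.e. they all lie in a common plane); and through each point of $\mathcal M_{\alpha,\beta}\cap\Sigma_\infty$ not on $\ell_1\cup\ell_2$ there passes exactly one line contained in $\mathcal M_{\alpha,\beta}$. (2) If $q\equiv 3\pmod 4$, then no line contained in $\mathcal M_{\alpha,\beta}$ passes through any affine point of $\mathcal M_{\alpha,\beta}$, whereas through each point of $(\mathcal M_{\alpha,\beta}\cap\Sigma_\infty)\setminus\{P_\infty\}$ there passes exactly one line contained in $\mathcal M_{\alpha,\beta}$. (3) In all cases, through $P_\infty$ there are exactly $q+1$ lines contained in $\mathcal M_{\alpha,\beta}$.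
   Context: Let $q$ be an odd prime power and let $(J,X,Y,Z)$ be homogeneous coordinates of $\mathrm{PG}(3,q^2)$. Let $\Sigma_\infty$ be the plane $J=0$ (the plane at infinity). Points not on $\Sigma_\infty$ are called affine, and points on $\Sigma_\infty$ are called points at infinity. Let $\mathcal B_{\alpha,\beta}$ be the set of points of $\mathrm{PG}(3,q^2)$ satisfying \[Z^qJ^q-ZJ^{2q-1}+\alpha^q(X^{2q}+Y^{2q})-\alpha(X^2+Y^2)J^{2q-2}=(\beta^q-\beta)(X^{q+1}+Y^{q+1})J^{q-1},\] let $\mathcal F=\{(0,X,Y,Z): X^{q+1}+Y^{q+1}=0\}\subset\Sigma_\infty$, and define the BM quasi-Hermitian variety \[\mathcal M_{\alpha,\beta}:=(\mathcal B_{\alpha,\beta}\setminus\Sigma_\infty)\cup\mathcal F .\] Let $\nu\in\mathrm{GF}(q^2)$ with $\nu^2=-1$. The set $\mathcal B_{\alpha,\beta}\cap\Sigma_\infty$ is the union of the two lines $\ell_1: X-\nu Y=0=J$ and $\ell_2: X+\nu Y=0=J$, which meet in $P_\infty=(0,0,0,1)$; when $q\equiv 1\pmod 4$ one has $\ell_1\cup\ell_2\subseteq\mathcal F$. ''Line'' means a line of $\mathrm{PG}(3,q^2)$ (with its $q^2+1$ points). *)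

(* Defs.v *)
From HB Require Import structures.
From mathcomp Require Import all_boot all_order all_algebra.

Set Implicit Arguments.
Unset Strict Implicit.
Unset Printing Implicit Defensive.

Import GRing.Theory.
Local Open Scope ring_scope.

(* Over a finite field there are finitely many subspaces: a subspace is encoded
   in MathComp by a canonical square matrix. *)
Section FiniteVspace.
Import VectorInternalTheory.
Variables (F : finFieldType) (vT : vectType F).
HB.instance Definition _ := [Countable of {vspace vT} by <:].
HB.instance Definition _ := [Finite of {vspace vT} by <:].
End FiniteVspace.

(* PG(3, F) is the lattice of subspaces of F^4; points, lines and planes are
   the subspaces of vector dimension 1, 2 and 3. *)
Section ProjectiveSpace.
Variable F : finFieldType.
Implicit Types (U P l : {vspace 'rV[F]_4}) (S : {set {vspace 'rV[F]_4}}).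

Definition pg_points U : {set {vspace 'rV[F]_4}} :=
  [set P : {vspace 'rV[F]_4} | (\dim P == 1%N) && (P <= U)%VS].

Definition pg_line l : bool := \dim l == 2%N.
Definition pg_plane U : bool := \dim U == 3%N.

(* Homogeneous coordinates (J, X, Y, Z). *)
Definition cJ (v : 'rV[F]_4) : F := v 0 0.
Definition cX (v : 'rV[F]_4) : F := v 0 1.
Definition cY (v : 'rV[F]_4) : F := v 0 2.
Definition cZ (v : 'rV[F]_4) : F := v 0 3.

Definition vec4 (j x y z : F) : 'rV[F]_4 := \row_(i < 4) [:: j; x; y; z]`_i.

(* The set of points having a coordinate vector satisfying E; for homogeneous E
   the choice of coordinate vector does not matter (mem_locus). *)
Definition locus (E : pred 'rV[F]_4) : {set {vspace 'rV[F]_4}} :=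
  [set <[v]>%VS | v : 'rV[F]_4 & (v != 0) && E v].

Lemma mem_locus (E : pred 'rV[F]_4) (v : 'rV[F]_4) :
    (forall (c : F) (w : 'rV[F]_4), c != 0 -> E (c *: w) = E w) ->
  v != 0 -> (<[v]>%VS \in locus E) = E v.
Proof.
move=> homE v0; apply/imsetP/idP => [[w] | Ev]; last first.
  by exists v; rewrite // inE v0.
rewrite inE => /andP[w0 Ew] eq_vw.
have /vlineP[c vE] : v \in <[w]>%VS by rewrite -eq_vw memv_line.
by rewrite vE homE //; apply: contraNneq v0 => c0; rewrite vE c0 scale0r.
Qed.

(* The lines of PG(3, F) through P all of whose points belong to S. *)
Definition lines_in S P : {set {vspace 'rV[F]_4}} :=
  [set l : {vspace 'rV[F]_4} | [&& pg_line l, (P <= l)%VS & pg_points l \subset S]].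

Definition Sigma_inf : {set {vspace 'rV[F]_4}} := locus (fun v => cJ v == 0).

Definition P_inf : {vspace 'rV[F]_4} := <[(vec4 0 0 0 1)%R]>%VS.

(* The point set of the line X - nu Y = 0 = J. *)
Definition ell (nu : F) : {set {vspace 'rV[F]_4}} :=
  locus (fun v => (cX v - nu * cY v == 0) && (cJ v == 0)).

End ProjectiveSpace.

Arguments Sigma_inf : clear implicits.
Arguments P_inf : clear implicits.

Section BMQuasiHermitian.
Variables (F : finFieldType) (q : nat) (alpha beta : F).

Definition BM_eq (v : 'rV[F]_4) : bool :=
  let J := cJ v in let X := cX v in let Y := cY v in let Z := cZ v in
  Z ^+ q * J ^+ q - Z * J ^+ (2 * q - 1)
    + alpha ^+ q * (X ^+ (2 * q) + Y ^+ (2 * q))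
    - alpha * (X ^+ 2 + Y ^+ 2) * J ^+ (2 * q - 2)
  == (beta ^+ q - beta) * (X ^+ (q + 1) + Y ^+ (q + 1)) * J ^+ (q - 1).

Lemma BM_eqZ (c : F) (v : 'rV[F]_4) : (0 < q)%N -> c != 0 ->
  BM_eq (c *: v) = BM_eq v.
Proof.
move=> q0 c0; rewrite /BM_eq /cJ /cX /cY /cZ !mxE -[RHS]subr_eq0 -subr_eq0.
set l := (X in X == 0); set r := (X in _ = (X == 0)).
suff -> : l = c ^+ (2 * q) * r by rewrite mulf_eq0 expf_eq0 (negPf c0) andbF.
rewrite {}/l {}/r !exprMn.
have e1 : c ^+ (2 * q) = c * c ^+ (2 * q - 1).
  by rewrite -exprS subn1 prednK // muln_gt0.
have e2 : c ^+ (2 * q) = c ^+ 2 * c ^+ (2 * q - 2).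
  by rewrite -exprD subnKC // leq_pmulr.
have e3 : c ^+ (2 * q) = c ^+ (q + 1) * c ^+ (q - 1).
  by rewrite -exprD addnBA // addnAC addnK addnn mul2n.
have e4 : c ^+ (2 * q) = c ^+ q * c ^+ q by rewrite -exprD addnn mul2n.
rewrite -!mulrDr !mulrBr [c ^+ (2 * q) * (_ - _ + _)]mulrDr mulrBr.
congr (_ - _ + _ - _ - _).
- by rewrite mulrACA -e4.
- by rewrite mulrACA -e1.
- by rewrite mulrCA.
- by rewrite [alpha * (_ * _)]mulrCA mulrACA -e2.
- by rewrite [_ * (c ^+ (q + 1) * _)]mulrCA mulrACA -e3.
Qed.

Definition BM_B : {set {vspace 'rV[F]_4}} := locus BM_eq.

Definition BM_F : {set {vspace 'rV[F]_4}} :=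
  locus (fun v => (cJ v == 0) && (cX v ^+ (q + 1) + cY v ^+ (q + 1) == 0)).

Definition BM_M : {set {vspace 'rV[F]_4}} := (BM_B :\: Sigma_inf F) :|: BM_F.

End BMQuasiHermitian.

(* Main.v *)
(* Write N for the norm x^(q+1) and b = beta^q - beta, so that b^q = -b.  Along
   (x,y,z) + t(m1,m2,m3) the affine equation is a polynomial in t with exponents
   among 0, 1, 2, q, q+1, 2q < q^2, so the line lies in M iff its base point and
   its point at infinity do, m1^2 + m2^2 = 0, and the coefficient of t vanishes
   (the coefficient of t^q is minus its q-th power).  Hence (m1:m2) = (s:1) with
   s = nu or -nu, N(s) = -1 (so q = 1 mod 4), and m3 is determined by the base
   point as -(2 alpha u + b u^q), where u = s x + y is constant on the line.  By
   the hypothesis on alpha and beta this map of u is a bijection, so the affine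
   lines through (0,s,1,z0) lie in one plane sX + Y = uJ, where they are
   parametrised by the q solutions of an equation z^q - z = c.
   The part F at infinity is the cone with vertex P_inf over the q+1 points with
   N(X/Y) = -1, and contains no line missing P_inf. *)
Require Import Defs.
From mathcomp Require Import all_boot all_order all_algebra.
From mathcomp Require Import all_field ring zify.
Import GRing.Theory.
Local Open Scope ring_scope.

Set Implicit Arguments.
Unset Strict Implicit.
Unset Printing Implicit Defensive.

(** * Root counts in a field of order q^2: fibres of x^(q+1) and of x^q - x *)

Section FiniteFieldRoots.
Variable F : finFieldType.

(** ['X^#|F| - 'X] is the product of all ['X - x], so each of its divisors is, up to a scalar, a
    product of distinct linear factors. *)
Lemma card_root_dvd (p : {poly F}) :
  p %| 'X^#|F| - 'X -> #|[set x | root p x]| = (size p).-1.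
Proof.
rewrite finField_genPoly => dvd_p.
have [m p_eq] := dvdp_prod_XsubC dvd_p.
rewrite (eqp_size p_eq) size_prod_XsubC /=.
rewrite -(card_uniqP (mask_uniq (index_enum_uniq F) m)).
apply: eq_card => x; rewrite inE (eqp_root p_eq).
exact: root_prod_XsubC.
Qed.

Lemma poly_eq0_of_roots (p : {poly F}) :
  (size p <= #|F|)%N -> (forall x, p.[x] = 0) -> p = 0.
Proof.
move=> sz_p p0; apply/eqP; apply: contraLR sz_p => nz_p; rewrite -ltnNge.
rewrite cardE; apply: max_poly_roots nz_p _ (enum_uniq _).
by apply/allP => x _; apply/rootP.
Qed.

Variable q : nat.
Hypothesis cardF : #|F| = (q ^ 2)%N.

Lemma frobK (x : F) : (x ^+ q) ^+ q = x.
Proof. by rewrite -exprM mulnn -cardF expf_card. Qed.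

Hypothesis q_gt1 : (1 < q)%N.

(** As q^2 = 1 + (q+1)(q-1) and c^(q-1) = 1, the polynomial X^(q^2) - X is X times a difference of
    (q-1)-th powers, of X^(q+1) and of c; it is therefore divisible by X^(q+1) - c. *)
Lemma card_norm_fiber (c : F) :
  c ^+ q.-1 = 1 -> #|[set x : F | x ^+ (q + 1) == c]| = (q + 1)%N.
Proof.
move=> c1; have sz : (size ('X^(q + 1) - c%:P : {poly F})).-1 = (q + 1)%N.
  by rewrite size_XnsubC ?addn1.
rewrite -[RHS]sz -card_root_dvd.
  by apply: eq_card => x; rewrite !inE rootE !hornerE subr_eq0.
have -> : 'X^#|F| - 'X = 'X * ('X^(q + 1) ^+ q.-1 - c%:P ^+ q.-1) :> {poly F}.
  rewrite -[c%:P ^+ _]rmorphXn /= c1 mulrBr mulr1 -exprM -exprS.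
  by congr ('X^_ - _); rewrite cardF; nia.
by rewrite dvdp_mull // subrXX dvdp_mulr.
Qed.

Hypothesis charF : [pchar F].-nat q.

Lemma frobD (x y : F) : (x + y) ^+ q = x ^+ q + y ^+ q.
Proof. exact: exprDn_pchar. Qed.

Lemma frobN (x : F) : (- x) ^+ q = - x ^+ q.
Proof.
have q0 : (0 < q)%N by apply: ltnW.
by apply/eqP; rewrite -addr_eq0 -frobD addNr expr0n gtn_eqF.
Qed.

Lemma frobB (x y : F) : (x - y) ^+ q = x ^+ q - y ^+ q.
Proof. by rewrite frobD frobN. Qed.

(** For P = X^q - X - c, additivity of the q-th power and c^q = -c give X^(q^2) - X = P^q + P, a
    multiple of P. *)
Lemma card_trace_fiber (c : F) :
  c ^+ q = - c -> #|[set x : F | x ^+ q - x == c]| = q.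
Proof.
move=> cN.
have szp : size ('X + c%:P : {poly F}) = 2%N by rewrite size_XaddC.
have sz : (size ('X^q - ('X + c%:P) : {poly F})).-1 = q.
  by rewrite size_polyDl size_polyXn // size_polyN szp.
rewrite -[RHS]sz -card_root_dvd.
  by apply: eq_card => x; rewrite !inE rootE !hornerE opprD addrA subr_eq0.
have charP : [pchar {poly F}].-nat q.
  by rewrite (eq_pnat _ (pchar_poly F)).
rewrite cardF expnS expn1 exprM.
set P := _ - _.
have -> : ('X^q) ^+ q - 'X = P ^+ q + P :> {poly F}.
  have -> : 'X^q = P + ('X + c%:P) by rewrite /P subrK.
  rewrite !exprDn_pchar // -[c%:P ^+ _]rmorphXn /= cN /P rmorphN /=; ring.
by rewrite -(prednK (ltnW q_gt1)) exprS -[X in _ + X]mulr1 -mulrDr dvdp_mulr.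
Qed.

End FiniteFieldRoots.

(** * Coordinates on F^4, and lines and planes as spans of vectors *)

Section Lines.
Variable F : finFieldType.
Implicit Types (u v w m : 'rV[F]_4) (l P : {vspace 'rV[F]_4}).

Lemma vec4_eta v : v = vec4 (cJ v) (cX v) (cY v) (cZ v).
Proof.
apply/rowP => i; rewrite mxE.
by case: i => [[|[|[|[|//]]]] i4] /=; congr (v _ _); apply: val_inj.
Qed.

Lemma coord_vec4 (j x y z : F) :
  (cJ (vec4 j x y z) = j) * (cX (vec4 j x y z) = x) *
  (cY (vec4 j x y z) = y) * (cZ (vec4 j x y z) = z).
Proof. by rewrite /cJ /cX /cY /cZ !mxE. Qed.

Lemma cJD (a b : F) u v : cJ (a *: u + b *: v) = a * cJ u + b * cJ v.
Proof. by rewrite /cJ !mxE. Qed.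
Lemma cXD (a b : F) u v : cX (a *: u + b *: v) = a * cX u + b * cX v.
Proof. by rewrite /cX !mxE. Qed.
Lemma cYD (a b : F) u v : cY (a *: u + b *: v) = a * cY u + b * cY v.
Proof. by rewrite /cY !mxE. Qed.
Lemma cZD (a b : F) u v : cZ (a *: u + b *: v) = a * cZ u + b * cZ v.
Proof. by rewrite /cZ !mxE. Qed.
Definition coord_comb := (cJD, cXD, cYD, cZD).

Lemma coordZ (a : F) v :
  (cJ (a *: v) = a * cJ v) * (cX (a *: v) = a * cX v) *
  (cY (a *: v) = a * cY v) * (cZ (a *: v) = a * cZ v).
Proof. by rewrite /cJ /cX /cY /cZ !mxE. Qed.

Lemma vec4_inj v w :
  cJ v = cJ w -> cX v = cX w -> cY v = cY w -> cZ v = cZ w -> v = w.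
Proof. by rewrite [v]vec4_eta [w]vec4_eta !coord_vec4 => -> -> -> ->. Qed.

Lemma coord0 : (cJ (0 : 'rV[F]_4) = 0) * (cX (0 : 'rV[F]_4) = 0) *
  (cY (0 : 'rV[F]_4) = 0) * (cZ (0 : 'rV[F]_4) = 0).
Proof. by rewrite /cJ /cX /cY /cZ !mxE. Qed.

Definition join u v : {vspace 'rV[F]_4} := (<[u]> + <[v]>)%VS.

Lemma mem_joinP u v w :
  reflect (exists a b, w = a *: u + b *: v) (w \in join u v).
Proof.
apply: (iffP memv_addP) => [[u' /vlineP[a ->] [v' /vlineP[b ->] ->]]|[a [b ->]]].
  by exists a, b.
exists (a *: u); rewrite ?memvZ ?memv_line //.
by exists (b *: v); rewrite ?memvZ ?memv_line.
Qed.

Lemma mem_joinl u v : u \in join u v.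
Proof. by apply/mem_joinP; exists 1, 0; rewrite scale1r scale0r addr0. Qed.

Lemma mem_joinr u v : v \in join u v.
Proof. by apply/mem_joinP; exists 0, 1; rewrite scale1r scale0r add0r. Qed.

Lemma dim_join u v : u != 0 -> v \notin <[u]>%VS -> \dim (join u v) = 2%N.
Proof.
move=> u0 uv; have v0 : v != 0 by apply: contraNneq uv => ->; rewrite mem0v.
rewrite dimv_disjoint_sum ?dim_vline ?u0 ?v0 //.
apply/eqP; rewrite -subv0; apply/subvP => w /memv_capP[/vlineP[a ->] /vlineP[b]].
have [-> | b0 e] := eqVneq b 0; first by rewrite scale0r memv0 => ->.
case/negP: uv; apply/vlineP; exists (b^-1 * a).
by rewrite -scalerA e scalerA mulVf // scale1r.
Qed.

Lemma dim_plane u v w : u != 0 -> v \notin <[u]>%VS -> w \notin join u v ->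
  \dim (join u v + <[w]>)%VS = 3%N.
Proof.
move=> u0 uv uvw; have w0 : w != 0 by apply: contraNneq uvw => ->; rewrite mem0v.
rewrite dimv_disjoint_sum ?dim_join ?dim_vline ?w0 //.
apply/eqP; rewrite -subv0; apply/subvP => x /memv_capP[xuv /vlineP[k xE]].
have [k0 | k0] := eqVneq k 0; first by rewrite xE k0 scale0r mem0v.
by case/negP: uvw; rewrite -[w](scalerK k0) -xE memvZ.
Qed.

Lemma line_join l u v : \dim l = 2%N -> u != 0 -> v \notin <[u]>%VS ->
  u \in l -> v \in l -> l = join u v.
Proof.
move=> l2 u0 uv ul vl; apply/eqP; rewrite eq_sym eqEdim dim_join // l2 leqnn andbT.
by apply/subvP => w /mem_joinP[a [b ->]]; rewrite memvD ?memvZ.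
Qed.

(** If u and v span the line and c(u) != 0, then c(v) u - c(u) v is killed by c. This serves to
    intersect a line with the planes J = 0, Y = 0 and Z = 0. *)
Lemma line_coord_zero l (c : 'rV[F]_4 -> F) : \dim l = 2%N ->
  (forall a b u v, c (a *: u + b *: v) = a * c u + b * c v) ->
  exists w, [/\ w \in l, w != 0 & c w = 0].
Proof.
move=> l2 cL; set u := vpick l.
have ul : u \in l := memv_pick l.
have l0 : l != 0%VS by rewrite -dimv_eq0 l2.
have u0 : u != 0 by rewrite vpick0.
have /subvPn[v vl vu] : ~~ (l <= <[u]>)%VS.
  by apply: contraTN isT => /dimvS; rewrite l2 dim_vline u0.
have [cu | cu] := eqVneq (c u) 0; first by exists u.
exists (c v *: u + (- c u) *: v); split.
- by rewrite memvD ?memvZ.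
- apply: contraNneq vu => e; apply/vlineP; exists ((c u)^-1 * c v).
  rewrite -scalerA; move/eqP: e; rewrite scaleNr subr_eq0 => /eqP ->.
  by rewrite scalerA mulVf // scale1r.
by rewrite cL; ring.
Qed.

Lemma pointP P : \dim P = 1%N -> exists2 v, v != 0 & P = <[v]>%VS.
Proof.
move=> P1; have v0 : vpick P != 0 by rewrite vpick0 -dimv_eq0 P1.
exists (vpick P) => //; apply/eqP.
by rewrite eq_sym eqEdim -memvE memv_pick dim_vline v0 P1.
Qed.

Lemma vlineZ (k : F) v : k != 0 -> <[k *: v]>%VS = <[v]>%VS.
Proof.
move=> k0; apply/eqP; rewrite eqEsubv -!memvE memvZ ?memv_line //=.
by apply/vlineP; exists k^-1; rewrite scalerK.
Qed.

(** Trades conditions on points, which are subspaces, for conditions on nonzero coordinate vectors;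
    [E] will be [inM]. *)
Lemma lines_inP (S : {set {vspace 'rV[F]_4}}) v l (E : pred 'rV[F]_4) :
    (forall w, w != 0 -> (<[w]>%VS \in S) = E w) ->
  reflect [/\ \dim l = 2%N, v \in l & forall w, w \in l -> w != 0 -> E w]
    (l \in lines_in S <[v]>%VS).
Proof.
move=> memS; rewrite inE /pg_line -memvE.
apply: (iffP and3P) => [[/eqP l2 vl /subsetP lS]|[l2 vl lS]]; split; rewrite ?l2 //.
  by move=> w wl w0; rewrite -memS // lS // inE -memvE wl dim_vline w0.
apply/subsetP => P; rewrite inE => /andP[/eqP /pointP[w w0 ->] wl].
by rewrite memS // lS // memvE.
Qed.

Lemma notin_vline_at_infinity u m :
  cJ u != 0 -> cJ m = 0 -> m != 0 -> m \notin <[u]>%VS.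
Proof.
move=> uJ mJ; apply: contra => /vlineP[k e]; move: mJ; rewrite e coordZ => /eqP.
by rewrite mulf_eq0 (negPf uJ) orbF => /eqP->; rewrite scale0r.
Qed.

Lemma cJ_neq0 u : cJ u != 0 -> u != 0.
Proof. by apply: contraNneq => ->; rewrite coord0. Qed.

End Lines.

(** * The variety in coordinates, and its equation along a line *)

Section BM.
Variables (F : finFieldType) (q : nat) (alpha beta : F).
Hypotheses (cardF : #|F| = (q ^ 2)%N) (charF : [pchar F].-nat q).
Hypotheses (q_gt2 : (2 < q)%N).
Hypothesis alpha_neq0 : alpha != 0.
Hypotheses (q_odd : odd q) (two_neq0 : (2 : F) != 0).

Local Notation b := (beta ^+ q - beta).
Local Notation M := (BM_M q alpha beta).
Local Notation e := (vec4 0 0 0 1 : 'rV[F]_4).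
Local Notation fD := (frobD charF).
Local Notation fK := (frobK cardF).

Lemma q_gt1 : (1 < q)%N. Proof. exact: ltnW. Qed.
Lemma q_gt0 : (0 < q)%N. Proof. exact: ltnW q_gt1. Qed.
#[local] Hint Resolve q_gt0 q_gt1 : core.

Local Notation fN := (frobN q_gt1 charF).
Local Notation fB := (frobB q_gt1 charF).

Lemma b_frob : b ^+ q = - b. Proof. by rewrite fB fK opprB. Qed.
Lemma frob2 : (2 : F) ^+ q = 2. Proof. by rewrite -[2]/(1 + 1) fD expr1n. Qed.
Lemma frob_sqr (x : F) : (x ^+ 2) ^+ q = (x ^+ q) ^+ 2. Proof. exact: exprAC. Qed.

(** Tests membership in [M] on a coordinate vector ([mem_BM_M]). The zero vector passes the test. *)
Definition inM (v : 'rV[F]_4) : bool :=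
  if cJ v == 0 then cX v ^+ (q + 1) + cY v ^+ (q + 1) == 0
  else BM_eq q alpha beta v.

Lemma norm_sum_eq0Z (k x y : F) : k != 0 ->
  ((k * x) ^+ (q + 1) + (k * y) ^+ (q + 1) == 0) = (x ^+ (q + 1) + y ^+ (q + 1) == 0).
Proof.
by move=> k0; rewrite !exprMn -mulrDr mulf_eq0 expf_eq0 (negPf k0) andbF.
Qed.

Lemma inMZ (k : F) v : k != 0 -> inM (k *: v) = inM v.
Proof.
by move=> k0; rewrite /inM !coordZ mulf_eq0 (negPf k0) /= norm_sum_eq0Z // BM_eqZ.
Qed.

Lemma mem_Sigma (v : 'rV[F]_4) : v != 0 -> (<[v]>%VS \in Sigma_inf F) = (cJ v == 0).
Proof.
by apply: mem_locus => k w k0; rewrite coordZ mulf_eq0 (negPf k0).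
Qed.

Lemma mem_BM_M v : v != 0 -> (<[v]>%VS \in M) = inM v.
Proof.
move=> v0; rewrite in_setU in_setD mem_Sigma // /inM.
rewrite mem_locus //; last by move=> k w; apply: BM_eqZ.
rewrite mem_locus //; first by case: (cJ v == 0) => //=; rewrite orbF.
by move=> k w k0; rewrite !coordZ mulf_eq0 (negPf k0) norm_sum_eq0Z.
Qed.

Lemma mem_ell (s : F) (v : 'rV[F]_4) : v != 0 ->
  (<[v]>%VS \in ell s) = (cX v == s * cY v) && (cJ v == 0).
Proof.
move=> v0; rewrite mem_locus ?subr_eq0 // => k w k0.
by rewrite !coordZ mulrCA -mulrBr !mulf_eq0 (negPf k0).
Qed.

(** The equation at J = 1, with all exponents expressed through q-th powers so that the Frobenius
    identities can rewrite it. *)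
Definition affine_eq (x y z : F) : F :=
  z ^+ q - z + alpha ^+ q * ((x ^+ q) ^+ 2 + (y ^+ q) ^+ 2)
  - alpha * (x ^+ 2 + y ^+ 2) - b * (x ^+ q * x + y ^+ q * y).

(* The Z-coordinate that a direction (0, m1, m2, _) needs for the linear term
   of the equation along the line through (1, x, y, _) to vanish. *)
Definition slope (x y m1 m2 : F) : F :=
  - (2 * alpha * (x * m1 + y * m2) + b * (x ^+ q * m1 + y ^+ q * m2)).

Lemma inM_affine (x y z : F) : inM (vec4 1 x y z) = (affine_eq x y z == 0).
Proof.
rewrite /inM /BM_eq !coord_vec4 oner_eq0 !expr1n !mulr1 !(mulnC 2 q) !exprM !addn1.
by rewrite ![_ ^+ q.+1]exprSr -subr_eq0.
Qed.

(** The coefficients of t^q and t^(2q) are minus the q-th powers of those of t and t^2. Hence only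
    the latter two, and the coefficient of t^(q+1), have to be controlled. *)
Lemma affine_eq_shift (x y z m1 m2 m3 t : F) :
  affine_eq (x + t * m1) (y + t * m2) (z + t * m3) =
  affine_eq x y z
  + (- (m3 - slope x y m1 m2)) * t + (- alpha * (m1 ^+ 2 + m2 ^+ 2)) * t ^+ 2
  + (m3 - slope x y m1 m2) ^+ q * t ^+ q
  + (- b * (m1 ^+ (q + 1) + m2 ^+ (q + 1))) * t ^+ q.+1
  + (alpha * (m1 ^+ 2 + m2 ^+ 2)) ^+ q * t ^+ (2 * q).
Proof.
rewrite /affine_eq /slope (mulnC 2 q) !exprM !addn1 ![_ ^+ q.+1]exprSr.
rewrite !(frob2, b_frob, fK, exprMn, frob_sqr, fB, fD, fN).
ring.
Qed.

(* For [2 < q] the exponents 1, 2, q, q + 1, 2q are distinct and less than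
   q^2 = #|F|, so the function determines the coefficients. *)
Lemma coef_vanish (A B C D E : F) :
  (forall t, A * t + B * t ^+ 2 + C * t ^+ q + D * t ^+ q.+1 + E * t ^+ (2 * q) = 0) ->
  A = 0 /\ B = 0.
Proof.
move=> P0.
pose p : {poly F} := A *: 'X + B *: 'X^2 + C *: 'X^q + D *: 'X^(q.+1) + E *: 'X^(2 * q).
have p0 : p = 0.
  apply: poly_eq0_of_roots => [|t]; last first.
    by rewrite /p !(hornerD, hornerZ, hornerXn, hornerX) P0.
  rewrite cardF.
  have szX (k : F) n : (n < q ^ 2)%N -> (size (k *: 'X^n : {poly F})%R <= q ^ 2)%N.
    by move=> nq; apply: leq_trans (size_scale_leq _ _) _; rewrite size_polyXn.
  rewrite /p -[X in A *: X]expr1.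
  have szD (f g : {poly F}) : (size f <= q ^ 2)%N -> (size g <= q ^ 2)%N ->
    (size (f + g)%R <= q ^ 2)%N.
    by move=> fq gq; apply: leq_trans (size_polyD _ _) _; rewrite geq_max fq.
  by rewrite !szD // szX //; rewrite expnS expn1; nia.
have q_ne n : (n < q)%N -> (n == q) = false by move=> nq; rewrite ltn_eqF.
have ne n : (n < q)%N -> (n == q.+1) = false by move=> nq; rewrite ltn_eqF // ltnW.
have ne2 n : (n < q)%N -> (n == 2 * q)%N = false.
  by move=> nq; rewrite ltn_eqF //; lia.
split.
  have : p`_1 = 0 by rewrite p0 coef0.
  by rewrite /p !coefE q_ne // ne // ne2 //= mulr1 !mulr0 !addr0.
have : p`_2 = 0 by rewrite p0 coef0.
by rewrite /p !coefE q_ne // ne // ne2 //= mulr1 !mulr0 !addr0 add0r.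
Qed.

(** The condition [inM m] on the point at infinity also makes the coefficient of t^(q+1) vanish; the
    last two conditions take care of the other coefficients. *)
Lemma affine_line_inM (x y z m1 m2 m3 : F) :
  let m := vec4 0 m1 m2 m3 in m != 0 ->
  (forall w, w \in join (vec4 1 x y z) m -> w != 0 -> inM w) <->
  [/\ inM (vec4 1 x y z), inM m, m1 ^+ 2 + m2 ^+ 2 = 0 & m3 = slope x y m1 m2].
Proof.
set u := vec4 1 x y z => m m0.
have shift t : 1 *: u + t *: m = vec4 1 (x + t * m1) (y + t * m2) (z + t * m3).
  by apply: vec4_inj; rewrite !coord_comb !coord_vec4 ?mul1r ?mulr0 ?addr0.
have norm_m : inM m = (m1 ^+ (q + 1) + m2 ^+ (q + 1) == 0).
  by rewrite /inM !coord_vec4 eqxx.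
split=> [lM | [uM mM mm m3E] w /mem_joinP[a [k ->]] w0].
  have uM : inM u by apply: lM (mem_joinl _ _) (cJ_neq0 _); rewrite coord_vec4 oner_neq0.
  have mM : inM m by apply: lM (mem_joinr _ _) m0.
  have [t|A0 B0] := @coef_vanish (- (m3 - slope x y m1 m2))
    (- alpha * (m1 ^+ 2 + m2 ^+ 2)) ((m3 - slope x y m1 m2) ^+ q)
    (- b * (m1 ^+ (q + 1) + m2 ^+ (q + 1))) ((alpha * (m1 ^+ 2 + m2 ^+ 2)) ^+ q).
    have : inM (1 *: u + t *: m).
      apply: lM; first by apply/mem_joinP; exists 1, t.
      by rewrite cJ_neq0 // coord_comb !coord_vec4 mulr1 mulr0 addr0 oner_neq0.
    rewrite shift inM_affine affine_eq_shift => /eqP.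
    by move: uM; rewrite inM_affine => /eqP ->; rewrite add0r.
  split=> //; last by apply/eqP; rewrite -subr_eq0 -oppr_eq0 A0.
  by move/eqP: B0; rewrite mulf_eq0 oppr_eq0 (negPf alpha_neq0) => /eqP.
(* The case a = 0 is the point at infinity; any other vector is a multiple of [u + t *: m] with t =
   k / a. *)
have [a0 | a0] := eqVneq a 0.
  move: w0; rewrite a0 scale0r add0r scaler_eq0 negb_or => /andP[k0 _].
  by rewrite inMZ.
have -> : a *: u + k *: m = a *: (1 *: u + (k / a) *: m).
  by rewrite scalerDr scale1r scalerA mulrCA divff // mulr1.
rewrite inMZ // shift inM_affine affine_eq_shift.
move: uM; rewrite inM_affine => /eqP ->.
move: mM; rewrite norm_m => /eqP ->.
by rewrite mm m3E subrr expr0n gtn_eqF // !mulr0 expr0n gtn_eqF // oppr0 !mul0r !addr0.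
Qed.

Lemma M_point (P : {vspace 'rV[F]_4}) :
  P \in M -> exists v, [/\ v != 0, P = <[v]>%VS & inM v].
Proof.
move=> PM; suff [v v0 PE] : exists2 v, v != 0 & P = <[v]>%VS.
  by exists v; rewrite -mem_BM_M // -PE.
by move: PM; rewrite !inE => /orP[/andP[_]|] /imsetP[v];
  rewrite inE => /andP[v0 _] ->; exists v.
Qed.

Lemma e_neq0 : e != 0.
Proof.
apply: contraTneq isT => e0; move: (coord0 F).
by rewrite -e0 !coord_vec4 => -[_ /eqP]; rewrite oner_eq0.
Qed.

Lemma vline_e (w : 'rV[F]_4) :
  (w \in <[e]>%VS) = [&& cJ w == 0, cX w == 0 & cY w == 0].
Proof.
apply/vlineP/and3P => [[k ->] | [/eqP wJ /eqP wX /eqP wY]].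
  by rewrite !coordZ !coord_vec4 !mulr0.
by exists (cZ w); apply: vec4_inj; rewrite !coordZ !coord_vec4 ?mulr0 ?mulr1.
Qed.

(** For J = Y = 0 the equation of the cone reduces to X^(q+1) = 0. *)
Lemma inM_inf_e (w : 'rV[F]_4) : cJ w = 0 -> cY w = 0 -> inM w -> w \in <[e]>%VS.
Proof.
move=> wJ wY; rewrite /inM vline_e wJ wY eqxx [0 ^+ _]expr0n addn1 addr0.
by rewrite expf_eq0 => /andP[_ ->].
Qed.

(* Otherwise the line would meet Y = 0 in a point with X != 0, which is not in M. *)
Lemma line_at_infinity_e (l : {vspace 'rV[F]_4}) : \dim l = 2%N ->
  (forall w, w \in l -> cJ w = 0) -> (forall w, w \in l -> w != 0 -> inM w) ->
  e \in l.
Proof.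
move=> l2 lJ lM; have [w [wl w0 wY]] := line_coord_zero l2 (@cYD F).
have /vlineP[k wE] := inM_inf_e (lJ _ wl) wY (lM _ wl w0).
have k0 : k != 0 by apply: contraNneq w0 => k0; rewrite wE k0 scale0r.
by rewrite -[e](scalerK k0) -wE memvZ.
Qed.

(** * Lines through an affine point *)

Lemma affine_or_inf (l : {vspace 'rV[F]_4}) :
  (forall w, w \in l -> cJ w = 0) \/ exists2 u, u \in l & cJ u = 1.
Proof.
have [/existsP[w /andP[wl wJ]] | no] := boolP [exists w, (w \in l) && (cJ w != 0)].
  by right; exists ((cJ w)^-1 *: w); rewrite ?memvZ // coordZ mulVf.
left=> w wl; apply/eqP; apply: contraNT no => wJ.
by apply/existsP; exists w; rewrite wl.
Qed.

Lemma affine_line_eq (l : {vspace 'rV[F]_4}) u m : \dim l = 2%N ->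
  u \in l -> cJ u = 1 -> m \in l -> cJ m = 0 -> m != 0 -> l = join u m.
Proof.
move=> l2 ul uJ ml mJ m0; have uJ0 : cJ u != 0 by rewrite uJ oner_neq0.
by apply: line_join; rewrite ?cJ_neq0 // notin_vline_at_infinity.
Qed.

(** If Y vanished at m, then X^2 + Y^2 = 0 would force X = 0, the slope and with it Z would be 0,
    and m would be zero. So directions can be scaled to Y = 1. *)
Lemma affine_line_direction (l : {vspace 'rV[F]_4}) u m : \dim l = 2%N ->
  (forall w, w \in l -> w != 0 -> inM w) ->
  u \in l -> cJ u = 1 -> m \in l -> cJ m = 0 -> m != 0 ->
  [/\ cX m ^+ 2 + cY m ^+ 2 = 0, cZ m = slope (cX u) (cY u) (cX m) (cY m)
    & cY m != 0].
Proof.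
move=> l2 lM ul uJ ml mJ m0.
have lE := affine_line_eq l2 ul uJ ml mJ m0.
move: m0; rewrite lE [u]vec4_eta [m]vec4_eta uJ mJ !coord_vec4 in lM * => m0.
have [_ _ iso mZ] := (affine_line_inM _ _ _ m0).1 lM.
split=> //; apply: contraNneq m0 => mY; move/eqP: iso.
rewrite mY expr0n addr0 expf_eq0 /= => /eqP mX.
rewrite mZ mX mY /slope !(mulr0, addr0, oppr0).
by apply/eqP/vec4_inj; rewrite coord0 coord_vec4.
Qed.

Definition dir (s x y : F) : 'rV[F]_4 := vec4 0 s 1 (slope x y s 1).

Lemma cY_neq0 (w : 'rV[F]_4) : cY w != 0 -> w != 0.
Proof. by apply: contraNneq => ->; rewrite coord0. Qed.

Lemma inM_vec4_inf (s z : F) : inM (vec4 0 s 1 z) = (s ^+ (q + 1) == -1).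
Proof. by rewrite /inM !coord_vec4 eqxx expr1n addr_eq0. Qed.

(** With the direction scaled to (0, s, 1, _), isotropy reads s^2 = -1, lying on the cone at
    infinity reads s^(q+1) = -1, and the slope fixes the Z-coordinate. *)
Lemma lines_affineP (x y z : F) (l : {vspace 'rV[F]_4}) :
  let u := vec4 1 x y z in inM u ->
  (l \in lines_in M <[u]>%VS) <->
  exists s, [/\ s ^+ 2 = -1, s ^+ (q + 1) = -1 & l = join u (dir s x y)].
Proof.
move=> u uM; have uJ : cJ u = 1 by rewrite coord_vec4.
split=> [/(lines_inP _ _ mem_BM_M)[l2 ul lM] | [s [s2 sq ->]]].
  have [m0 [m0l m0n m0J]] := line_coord_zero l2 (@cJD F).
  have [_ _ Y0] := affine_line_direction l2 lM ul uJ m0l m0J m0n.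
  set m := (cY m0)^-1 *: m0.
  have ml : m \in l by rewrite memvZ.
  have mJ : cJ m = 0 by rewrite coordZ m0J mulr0.
  have mY : cY m = 1 by rewrite coordZ mulVf.
  have mn : m != 0 by rewrite cY_neq0 // mY oner_neq0.
  have [iso mZ _] := affine_line_direction l2 lM ul uJ ml mJ mn.
  have mE : m = dir (cX m) x y.
    by apply: vec4_inj; rewrite ?mZ /dir ?coord_vec4 ?mY // /u !coord_vec4.
  exists (cX m); split; last by rewrite -mE; apply: affine_line_eq.
    by move/eqP: iso; rewrite mY expr1n addr_eq0 => /eqP.
  by apply/eqP; rewrite -(inM_vec4_inf _ (slope x y (cX m) 1)) -/(dir _ _ _) -mE lM.
have mn : dir s x y != 0 by rewrite cY_neq0 // coord_vec4 oner_neq0.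
apply/(lines_inP _ _ mem_BM_M); split; last 1 first.
- apply/(affine_line_inM _ _ _ mn); split=> //.
    by rewrite inM_vec4_inf sq.
  by rewrite s2 expr1n addNr.
- apply: dim_join; first by rewrite cJ_neq0 // uJ oner_neq0.
  by rewrite notin_vline_at_infinity ?uJ ?oner_neq0 // coord_vec4.
exact: mem_joinl.
Qed.

(** * Lines at infinity and the lines through [P_inf] *)

Lemma inM_join_e (m w : 'rV[F]_4) : cJ m = 0 -> inM m -> w \in join e m -> inM w.
Proof.
move=> mJ mM /mem_joinP[a [k ->]]; move: mM.
rewrite /inM !coord_comb !coord_vec4 mJ !mulr0 !add0r eqxx => /eqP mM.
by rewrite !exprMn -mulrDr mM mulr0.
Qed.

Lemma join_e_in (m : 'rV[F]_4) : cJ m = 0 -> inM m -> m \notin <[e]>%VS ->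
  join e m \in lines_in M <[m]>%VS.
Proof.
move=> mJ mM me; apply/(lines_inP _ _ mem_BM_M); split.
- exact: dim_join e_neq0 me.
- exact: mem_joinr.
by move=> w wl _; apply: inM_join_e wl.
Qed.

Lemma join_e_in_e (m : 'rV[F]_4) : cJ m = 0 -> inM m -> m \notin <[e]>%VS ->
  join e m \in lines_in M (P_inf F).
Proof.
move=> mJ mM me; apply/(lines_inP _ _ mem_BM_M); split.
- exact: dim_join e_neq0 me.
- exact: mem_joinl.
by move=> w wl _; apply: inM_join_e wl.
Qed.

(** A line at infinity contained in [M] passes through the vertex [e], so once affine lines are
    excluded it is spanned by [e] and [m]. *)
Lemma lines_inf_eq (m : 'rV[F]_4) : cJ m = 0 -> inM m -> m \notin <[e]>%VS ->
  (forall l, l \in lines_in M <[m]>%VS -> forall w, w \in l -> cJ w = 0) ->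
  lines_in M <[m]>%VS = [set join e m].
Proof.
move=> mJ mM me lJ; apply/setP => l; rewrite in_set1.
apply/idP/eqP => [lm | ->].
  have /(lines_inP _ _ mem_BM_M)[l2 ml lM] := lm.
  by apply: line_join; rewrite ?e_neq0 // line_at_infinity_e //; apply: lJ.
exact: join_e_in.
Qed.

(** Here (q+1)/2 is odd. *)
Lemma sqrtN1_norm1 (s : F) : (q = 1 %[mod 4])%N -> s ^+ 2 = -1 -> s ^+ (q + 1) = -1.
Proof.
move=> q1 s2; have -> : (q + 1 = 2 * (2 * (q %/ 4)).+1)%N by lia.
by rewrite exprM s2 exprS exprM sqrrN !expr1n mulr1.
Qed.

(** Here (q+1)/2 is even, so the power is 1, which differs from -1 because 2 != 0. *)
Lemma sqrtN1_norm3 (s : F) : (q = 3 %[mod 4])%N -> s ^+ 2 = -1 -> s ^+ (q + 1) != -1.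
Proof.
move=> q3 s2; have -> : (q + 1 = 2 * (2 * (q %/ 4).+1))%N by lia.
by rewrite exprM s2 exprM sqrrN !expr1n eq_sym -subr_eq0 -opprD oppr_eq0.
Qed.

(** An affine line through [P_inf] would have the direction [e], whose Y-coordinate is 0. A line at
    infinity through [P_inf] meets Z = 0 in a point that scales to (0, k, 1, 0). *)
Lemma lines_P_inf :
  lines_in M (P_inf F) =
  [set join e (vec4 0 k 1 0) | k in [set k : F | k ^+ (q + 1) == -1]].
Proof.
apply/setP => l; apply/idP/imsetP => [/(lines_inP _ _ mem_BM_M)[l2 el lM] | [k]].
  have eJ : cJ e = 0 by rewrite coord_vec4.
  have lJ w : w \in l -> cJ w = 0.
    have [lJ | [u ul uJ]] := affine_or_inf l; first exact: lJ.
    have [_ _] := affine_line_direction l2 lM ul uJ el eJ e_neq0.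
    by rewrite coord_vec4 eqxx.
  have [w [wl w0 wZ]] := line_coord_zero l2 (@cZD F).
  have wJ := lJ w wl.
  have we : w \notin <[e]>%VS.
    apply: contra w0; rewrite vline_e => /and3P[_ /eqP wX /eqP wY].
    by apply/eqP/vec4_inj; rewrite coord0.
  have wY : cY w != 0 by apply: contraNneq we => wY; apply: inM_inf_e; rewrite ?lM.
  have wE : (cY w)^-1 *: w = vec4 0 (cX w / cY w) 1 0.
    by apply: vec4_inj; rewrite !coordZ coord_vec4 ?wJ ?wZ ?mulr0 ?mulVf // mulrC.
  exists (cX w / cY w).
    rewrite inE -(inM_vec4_inf _ 0) -wE lM ?memvZ //.
    by rewrite wE cY_neq0 // coord_vec4 oner_neq0.
  apply: line_join; rewrite ?e_neq0 //; first by rewrite vline_e !coord_vec4 oner_eq0 !andbF.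
  by rewrite -wE memvZ.
rewrite inE => kN ->; apply: join_e_in_e; rewrite ?coord_vec4 ?inM_vec4_inf //.
by rewrite vline_e !coord_vec4 oner_eq0 !andbF.
Qed.

Lemma card_lines_P_inf : #|lines_in M (P_inf F)| = (q + 1)%N.
Proof.
rewrite lines_P_inf card_in_imset => [|k k' _ _ kk'].
  (* The side condition (-1)^(q-1) = 1 holds because q is odd. *)
  rewrite (card_norm_fiber cardF q_gt1) // -signr_odd.
  by have -> : odd q.-1 = false by lia.
have /mem_joinP[a [c kE]] : vec4 0 k 1 0 \in join e (vec4 0 k' 1 0).
  by rewrite -kk' mem_joinr.
have := congr1 (@cY F) kE; rewrite coord_comb !coord_vec4 mulr0 add0r mulr1 => c1.
have := congr1 (@cX F) kE; rewrite coord_comb !coord_vec4 mulr0 add0r -c1 mul1r.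
by [].
Qed.

(** The common plane is J = 0. Since [P_inf] lies on both lines [ell], the claim about pencils
    includes it. *)
Lemma lines_P_inf_coplanar :
  exists2 U, pg_plane U & forall l, l \in lines_in M (P_inf F) -> (l <= U)%VS.
Proof.
pose f1 : 'rV[F]_4 := vec4 0 1 0 0; pose f2 : 'rV[F]_4 := vec4 0 0 1 0.
exists (join e f1 + <[f2]>)%VS.
  apply/eqP; apply: dim_plane; first exact: e_neq0.
    by rewrite vline_e !coord_vec4 oner_eq0 andbF.
  apply/negP => /mem_joinP[a [k fE]].
  by have /eqP := congr1 (@cY F) fE; rewrite coord_comb !coord_vec4 !mulr0 addr0 oner_eq0.
rewrite lines_P_inf => l /imsetP[k _ ->].
have -> : vec4 0 k 1 0 = k *: f1 + 1 *: f2.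
  by apply: vec4_inj; rewrite coord_comb !coord_vec4 ?mulr0 ?mulr1 ?addr0 ?add0r.
apply/subvP => w /mem_joinP[a [c ->]].
rewrite scale1r scalerDr addrA memv_add // ?memvZ ?memv_line //.
by rewrite memvD ?memvZ ?mem_joinl ?mem_joinr.
Qed.

(** * Lines through a point (0, s, 1, z0) with s^2 = s^(q+1) = -1 *)

Section PointOnEll.
Variables (s z0 : F).
Hypotheses (s2 : s ^+ 2 = -1) (sq : s ^+ (q + 1) = -1).
Hypothesis alpha_beta : 4 * alpha ^+ (q + 1) + b ^+ 2 != 0.
Local Notation m := (vec4 0 s 1 z0 : 'rV[F]_4).

Lemma s_neq0 : s != 0.
Proof.
apply: contraTneq isT => s0; move/eqP: s2.
by rewrite s0 expr0n eq_sym oppr_eq0 oner_eq0.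
Qed.

(** The map is additive, so injectivity concerns the solutions d of 2 alpha d = -b d^q. Eliminating
    d^q with the conjugate equation leaves (4 alpha^(q+1) + b^2) d = 0. *)
Lemma slope_bij : bijective (fun y => slope 0 y s 1).
Proof.
apply: injF_bij => y y'; rewrite /slope => /oppr_inj.
rewrite !mul0r !mulr1 expr0n gtn_eqF // mul0r !add0r => yy'.
set d := y - y'.
have d1 : 2 * alpha * d = - b * d ^+ q.
  rewrite fB; apply/eqP; rewrite -subr_eq0; move/eqP: yy'.
  by rewrite -subr_eq0 /d => /eqP <-; apply/eqP; ring.
(* the q-th power of [d1]; the two are a linear system in d, d^q *)
have d2 : 2 * alpha ^+ q * d ^+ q = b * d.
  by have := congr1 (fun t => t ^+ q) d1; rewrite !(exprMn, frob2, fN, b_frob, fK) opprK.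
have : (4 * alpha ^+ (q + 1) + b ^+ 2) * d = 0.
  have -> : (4 * alpha ^+ (q + 1) + b ^+ 2) * d =
     2 * alpha ^+ q * (2 * alpha * d) + b * (b * d) by rewrite addn1 exprSr; ring.
  by rewrite d1 -d2; ring.
by move/eqP; rewrite mulf_eq0 (negPf alpha_beta) subr_eq0 => /eqP.
Qed.

(** As s != 0, every affine line through [m] has exactly one point (1, 0, y, z). Its y is the
    preimage of z0 under the slope map, and z only has to satisfy the equation of the variety. *)
Lemma lines_ell : exists y c, c ^+ q = - c /\
  lines_in M <[m]>%VS =
  join e m |: [set join (vec4 1 0 y z) m | z in [set z : F | z ^+ q - z == c]].
Proof.
have [g gK Kg] := slope_bij; pose y := g z0.
have y0 : slope 0 y s 1 = z0 := Kg z0.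
(* Chosen so that [affine_eq 0 y z] equals z^q - z - c. *)
pose c := alpha * y ^+ 2 - alpha ^+ q * (y ^+ q) ^+ 2 + b * (y ^+ q * y).
have mJ : cJ m = 0 by rewrite coord_vec4.
have mX : cX m = s by rewrite coord_vec4.
have mY : cY m = 1 by rewrite coord_vec4.
have mZ : cZ m = z0 by rewrite coord_vec4.
have mn : m != 0 by rewrite cY_neq0 // mY oner_neq0.
have mM : inM m by rewrite inM_vec4_inf sq.
have me : m \notin <[e]>%VS by rewrite vline_e mY oner_eq0 !andbF.
have affE z : (affine_eq 0 y z == 0) = (z ^+ q - z == c).
  rewrite -[RHS]subr_eq0 /affine_eq /c; congr (_ == 0).
  by rewrite !expr0n gtn_eqF //=; ring.
exists y, c; split.
  by rewrite /c !(frob2, b_frob, fK, exprMn, frob_sqr, fB, fD, fN); ring.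
apply/setP => l; rewrite in_setU1; apply/idP/idP; last first.
  case/predU1P => [->|/imsetP[z]]; first exact: join_e_in.
  rewrite inE -affE => zc ->; apply/(lines_inP _ _ mem_BM_M).
  have uJ : cJ (vec4 1 0 y z) = 1 by rewrite coord_vec4.
  split; last 1 first.
  - apply/(affine_line_inM _ _ _ mn); split=> //; first by rewrite inM_affine.
    by rewrite s2 expr1n addNr.
  - apply: dim_join; first by rewrite cJ_neq0 // uJ oner_neq0.
    by rewrite notin_vline_at_infinity ?uJ ?oner_neq0.
  exact: mem_joinr.
move=> /(lines_inP _ _ mem_BM_M)[l2 ml lM]; apply/predU1P.
have [lJ | [u0 u0l u0J]] := affine_or_inf l.
  by left; apply: line_join; rewrite ?e_neq0 // line_at_infinity_e.
(* Slide the affine point along the line to X = 0. *)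
right; pose u := 1 *: u0 + (- (cX u0 / s)) *: m.
have ul : u \in l by rewrite memvD ?memvZ.
have uJ : cJ u = 1 by rewrite coord_comb u0J mJ mulr0 addr0 mulr1.
have uX : cX u = 0 by rewrite coord_comb mX mul1r mulNr (divfK s_neq0) subrr.
have [_ zE _] := affine_line_direction l2 lM ul uJ ml mJ mn.
have uY : cY u = y.
  by rewrite /y -mZ zE uX mX mY gK.
have uE : u = vec4 1 0 y (cZ u) by apply: vec4_inj; rewrite coord_vec4.
apply/imsetP; exists (cZ u); last by rewrite -uE; apply: affine_line_eq.
by rewrite inE -affE -inM_affine -uE lM // cJ_neq0 // uJ oner_neq0.
Qed.

(** One line at infinity and q affine ones. They lie in the plane s X + Y = y J, spanned by [e], [m]
    and (1, 0, y, 0). *)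
Lemma card_lines_ell : #|lines_in M <[m]>%VS| = (q + 1)%N /\
  exists2 U, pg_plane U & forall l, l \in lines_in M <[m]>%VS -> (l <= U)%VS.
Proof.
have [y [c [cN ->]]] := lines_ell.
have mJ : cJ m = 0 by rewrite coord_vec4.
have mY : cY m = 1 by rewrite coord_vec4.
have me : m \notin <[e]>%VS by rewrite vline_e mY oner_eq0 !andbF.
split.
  rewrite cardsU1 card_in_imset => [|z z' _ _ zz'].
    rewrite (card_trace_fiber cardF q_gt1) // addnC; congr (_ + _)%N.
    suff -> : join e m \notin
      [set join (vec4 1 0 y z) m | z in [set z | z ^+ q - z == c]] by [].
    apply/imsetP => -[z _ lE].
    have /mem_joinP[a [k uE]] : vec4 1 0 y z \in join e m by rewrite lE mem_joinl.
    by have /eqP := congr1 (@cJ F) uE; rewrite coord_comb !coord_vec4 !mulr0 addr0 oner_eq0.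
  have /mem_joinP[a [k uE]] : vec4 1 0 y z \in join (vec4 1 0 y z') m.
    by rewrite -zz' mem_joinl.
  have := congr1 (@cJ F) uE; rewrite coord_comb !coord_vec4 mulr1 mulr0 addr0 => a1.
  (* Both base points have X = 0 while [m] has X = s != 0, so they coincide. *)
  have /eqP := congr1 (@cX F) uE; rewrite coord_comb !coord_vec4 mulr0 add0r eq_sym.
  rewrite mulf_eq0 (negPf s_neq0) orbF => /eqP k0.
  by have := congr1 (@cZ F) uE; rewrite coord_comb !coord_vec4 k0 -a1 mul1r mul0r addr0.
have uJ z : cJ (vec4 1 0 y z) != 0 by rewrite coord_vec4 oner_neq0.
have eJ : cJ e = 0 by rewrite coord_vec4.
have lJ w : w \in join e m -> cJ w = 0.
  by case/mem_joinP => a [k ->]; rewrite coord_comb eJ mJ !mulr0 addr0.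
exists (join e m + <[(vec4 1 0 y 0)%R]>)%VS.
  apply/eqP; apply: dim_plane => //; first exact: e_neq0.
  by apply/negP => /lJ/eqP; rewrite (negPf (uJ 0)).
move=> l /setU1P[-> | /imsetP[z _ ->]]; first exact: addvSl.
apply/subvP => w /mem_joinP[a [k ->]].
have -> : vec4 1 0 y z = vec4 1 0 y 0 + z *: e.
  rewrite -[vec4 1 0 y 0]scale1r.
  by apply: vec4_inj; rewrite coord_comb !coord_vec4 mul1r ?mulr0 ?mulr1 ?addr0 ?add0r.
rewrite scalerDr -addrA addrC memv_add ?memvZ ?memv_line //.
by rewrite memvD ?memvZ ?mem_joinl ?mem_joinr.
Qed.

End PointOnEll.

(** * Counts for each type of point *)

Lemma card_lines_affine (nu x y z : F) : (q = 1 %[mod 4])%N -> nu ^+ 2 = -1 ->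
  inM (vec4 1 x y z) -> #|lines_in M <[(vec4 1 x y z)%R]>%VS| = 2%N.
Proof.
move=> q1 nu2 uM; set u := vec4 1 x y z.
have -> : lines_in M <[u]>%VS = [set join u (dir nu x y); join u (dir (- nu) x y)].
  apply/setP => l; rewrite in_set2; apply/idP/orP.
    case/(lines_affineP _ uM) => s [s2 _ ->].
    have : s ^+ 2 == nu ^+ 2 by rewrite s2 nu2.
    by rewrite eqf_sqr => /orP[] /eqP->; [left | right].
  have nu2' : (- nu) ^+ 2 = -1 by rewrite sqrrN.
  by case=> /eqP->; apply/(lines_affineP _ uM);
    [exists nu | exists (- nu)]; split=> //; apply: sqrtN1_norm1.
rewrite cards2; suff -> : join u (dir nu x y) != join u (dir (- nu) x y) by [].
apply/eqP => lE.
have /mem_joinP[a [k dE]] : dir nu x y \in join u (dir (- nu) x y).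
  by rewrite -lE mem_joinr.
have := congr1 (@cJ F) dE; rewrite coord_comb !coord_vec4 mulr1 mulr0 addr0 => a0.
have := congr1 (@cY F) dE; rewrite coord_comb !coord_vec4 -a0 mul0r add0r mulr1 => k1.
have /eqP := congr1 (@cX F) dE; rewrite coord_comb !coord_vec4 -a0 mul0r add0r -k1 mul1r.
(* Equal lines would give nu = -nu, hence nu = 0. *)
rewrite -addr_eq0 -mulr2n -mulr_natl mulf_eq0 (negPf two_neq0) /= => /eqP nu0.
by move/eqP: nu2; rewrite nu0 expr0n eq_sym oppr_eq0 oner_eq0.
Qed.

Lemma lines_affine0 (x y z : F) : (q = 3 %[mod 4])%N ->
  inM (vec4 1 x y z) -> lines_in M <[(vec4 1 x y z)%R]>%VS = set0.
Proof.
move=> q3 uM; apply/setP => l; rewrite in_set0; apply/negP.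
by case/(lines_affineP _ uM) => s [s2 sq _]; case/eqP: (sqrtN1_norm3 q3 s2).
Qed.

Lemma affine_point (P : {vspace 'rV[F]_4}) : P \in M :\: Sigma_inf F ->
  exists x y z, P = <[(vec4 1 x y z)%R]>%VS /\ inM (vec4 1 x y z).
Proof.
rewrite inE => /andP[+ PM]; have [v [v0 -> vM]] := M_point PM.
rewrite mem_Sigma // => vJ; have k0 : (cJ v)^-1 != 0 by rewrite invr_eq0.
have uE : (cJ v)^-1 *: v =
    vec4 1 (cX v / cJ v) (cY v / cJ v) (cZ v / cJ v).
  by apply: vec4_inj; rewrite !coordZ coord_vec4 ?mulVf // mulrC.
exists (cX v / cJ v), (cY v / cJ v), (cZ v / cJ v).
by rewrite -uE inMZ // vlineZ.
Qed.

(** An affine line through m forces X^2 + Y^2 = 0, so X/Y squares to -1, and [inM m] gives it norm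
    -1; this is impossible when q = 3 mod 4. The alternative hypothesis covers the points off the
    two lines when q = 1 mod 4. *)
Lemma card_lines_inf (m : 'rV[F]_4) : cJ m = 0 -> inM m -> m \notin <[e]>%VS ->
  (q = 3 %[mod 4])%N \/ cX m ^+ 2 + cY m ^+ 2 != 0 ->
  #|lines_in M <[m]>%VS| = 1%N.
Proof.
move=> mJ mM me mq; rewrite lines_inf_eq ?cards1 // => l.
case/(lines_inP _ _ mem_BM_M) => l2 ml lM.
have [//| [u ul uJ]] := affine_or_inf l.
have mn : m != 0 by apply: contraNneq me => ->; rewrite mem0v.
have [iso _ mY] := affine_line_direction l2 lM ul uJ ml mJ mn.
case: mq => [q3 | /eqP//].
have s2 : (cX m / cY m) ^+ 2 = -1.
  rewrite expr_div_n; move/eqP: iso; rewrite addr_eq0 => /eqP ->.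
  by rewrite mulNr divff // expf_neq0.
case/eqP: (sqrtN1_norm3 q3 s2); apply/eqP.
rewrite expr_div_n -addr_eq0; move: mM; rewrite /inM mJ eqxx => /eqP mM.
by rewrite -[X in _ + X](divff (expf_neq0 (q + 1) mY)) -mulrDl mM mul0r.
Qed.

Lemma inf_point (P : {vspace 'rV[F]_4}) : P \in M :&: Sigma_inf F ->
  exists m, [/\ m != 0, P = <[m]>%VS, cJ m = 0 & inM m].
Proof.
rewrite inE => /andP[PM]; have [m [m0 -> mM]] := M_point PM.
by rewrite mem_Sigma // => /eqP mJ; exists m.
Qed.

(** The only point of the line with Y = 0 is [P_inf], handled by the cone; every other one scales to
    (0, s, 1, z0). *)
Lemma card_lines_on_ell (s : F) (P : {vspace 'rV[F]_4}) :
  (q = 1 %[mod 4])%N -> s ^+ 2 = -1 -> 4 * alpha ^+ (q + 1) + b ^+ 2 != 0 ->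
  P \in ell s -> #|lines_in M P| = (q + 1)%N /\
  exists2 U, pg_plane U & forall l, l \in lines_in M P -> (l <= U)%VS.
Proof.
move=> q1 s2 ab Ps; have [v v0 PE] : exists2 v, v != 0 & P = <[v]>%VS.
  by case/imsetP: Ps => v; rewrite inE => /andP[v0 _] ->; exists v.
move: Ps; rewrite PE mem_ell // => /andP[/eqP vX /eqP vJ].
have [vY | vY] := eqVneq (cY v) 0.
  have /vlineP[k vE] : v \in <[e]>%VS by rewrite vline_e vJ vX vY mulr0 eqxx.
  have k0 : k != 0 by apply: contraNneq v0 => k0; rewrite vE k0 scale0r.
  have -> : <[v]>%VS = P_inf F by rewrite vE vlineZ.
  by rewrite card_lines_P_inf; split=> //; apply: lines_P_inf_coplanar.
have -> : <[v]>%VS = <[(vec4 0 s 1 (cZ v / cY v))%R]>%VS.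
  have k0 : (cY v)^-1 != 0 by rewrite invr_eq0.
  rewrite -(vlineZ v k0); congr <[_]>%VS.
  by apply: vec4_inj; rewrite !coordZ coord_vec4 ?vJ ?vX ?mulr0 ?mulVf // mulrC // mulfK.
by apply: card_lines_ell; rewrite // sqrtN1_norm1.
Qed.

End BM.

Theorem theorem3p4
  (p h q : nat) (p_prime : prime p) (p_odd : odd p) (h_gt0 : (0 < h)%N)
  (qE : q = (p ^ h)%N)
  (F : finFieldType) (cardF : #|F| = (q ^ 2)%N)
  (GFq : {set F}) (GFq_subfield : divring_closed GFq) (card_GFq : #|GFq| = q)
  (alpha beta nu : F)
  (alpha_neq0 : alpha != 0) (beta_notin : beta \notin GFq)
  (alpha_beta : 4 * alpha ^+ (q + 1) + (beta ^+ q - beta) ^+ 2 != 0)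
  (nuE : nu ^+ 2 = -1) :
  let M := BM_M q alpha beta in
  let ells := ell nu :|: ell (- nu) in
  [/\ (q = 1 %[mod 4])%N ->
        [/\ forall P, P \in M :\: Sigma_inf F -> #|lines_in M P| = 2%N,
            forall P, P \in ells ->
              #|lines_in M P| = (q + 1)%N /\
              exists2 U, pg_plane U & forall l, l \in lines_in M P -> (l <= U)%VS
          & forall P, P \in (M :&: Sigma_inf F) :\: ells ->
              #|lines_in M P| = 1%N],
      (q = 3 %[mod 4])%N ->
        (forall P, P \in M :\: Sigma_inf F -> #|lines_in M P| = 0%N) /\
        (forall P, P \in (M :&: Sigma_inf F) :\ P_inf F ->
           #|lines_in M P| = 1%N)
    & #|lines_in M (P_inf F)| = (q + 1)%N].
Proof.
have p_gt1 := prime_gt1 p_prime.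
have q_odd : odd q by rewrite qE oddX p_odd orbT.
have q_gt2 : (2 < q)%N.
  have : (1 < q)%N by rewrite qE -(exp1n h) ltn_exp2r.
  by move: q_odd; clear; case: q => [|[|[|]]].
have pF : p \in [pchar F].
  by apply: (@card_finPcharP _ _ (h * 2)); rewrite // cardF qE expnM.
have charF : [pchar F].-nat q.
  by rewrite qE pnatX; apply/orP; left; rewrite pnatE.
have two_neq0 : (2 : F) != 0.
  apply/negP; rewrite -(dvdn_pcharf pF) dvdn_prime2 // => /eqP p2.
  by move: p_odd; rewrite p2.
have nuE' : (- nu) ^+ 2 = -1 by rewrite sqrrN.
move=> M ells.
(* X^2 + Y^2 factors as (X - nu Y)(X + nu Y). *)
have mem_ells v : v != 0 -> (<[v]>%VS \in ells) =
    (cX v ^+ 2 + cY v ^+ 2 == 0) && (cJ v == 0).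
  move=> v0; rewrite in_setU !mem_ell // -andb_orl; congr (_ && _).
  have -> : cX v ^+ 2 + cY v ^+ 2 = cX v ^+ 2 - (nu * cY v) ^+ 2.
    by rewrite exprMn nuE mulN1r opprK.
  by rewrite subr_eq0 eqf_sqr mulNr.
split=> [q1 | q3 |]; last exact: card_lines_P_inf.
  split=> [P /(affine_point q_gt2)[x [y [z [-> uM]]]] | P | P].
  - by apply: (@card_lines_affine F q alpha beta) nuE uM.
  - by rewrite inE => /orP[]; apply: card_lines_on_ell.
  - rewrite in_setD => /andP[+ /(inf_point q_gt2)[m [m0 PE mJ mM]]].
    rewrite PE mem_ells // mJ eqxx andbT => iso.
    apply: card_lines_inf => //; last by right.
    (* A multiple of [e] has X = Y = 0 and would lie on the two lines. *)
    by apply: contra iso; rewrite vline_e => /and3P[_ /eqP-> /eqP->]; rewrite expr0n addr0.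
split=> [P /(affine_point q_gt2)[x [y [z [-> uM]]]] | P].
  by rewrite lines_affine0 ?cards0.
rewrite in_setD1 => /andP[Pe /(inf_point q_gt2)[m [m0 PE mJ mM]]].
rewrite PE; apply: card_lines_inf => //; last by left.
apply: contra Pe => /vlineP[k mE]; rewrite PE mE vlineZ //.
by apply: contraNneq m0 => k0; rewrite mE k0 scale0r.
Qed.
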